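(* Let $H=(V,E)$ be a hypergraph, let $H'$ be its intersection-closure, and let $d$ be a positive integer. The following are equivalent: (i) $H$ is $(d+1)$-semi-ladder-free; (ii) $H'$ is $(d+1)$-ladder-free; (iii) $L(H')\le d+1$.
   Context: A hypergraph is a pair $H=(V,E)$ with $V$ a finite set and $E\subseteq 2^V$. For an integer $d\ge1$, a $d$-semi-ladder in $H$ is a pair $(W,F)$ with $W=\{w_0,\ldots,w_d\}\subseteq V$, $F=\{f_0,\ldots,f_d\}\subseteq E$, such that $w_i\notin f_i$ for each $i\in[0;d]$ and $w_i\in f_j$ whenever $0\le i<j\le d$. A $d$-ladder is such a pair $(W,F)$ with $w_i\in f_j\iff i<j$ for all $i,j\in[0;d]$. $H$ is $d$-semi-ladder-free (resp. $d$-ladder-free) if it has no $d$-semi-ladder (resp. $d$-ladder). $H$ is intersection-closed if $V\in E$ and $e\cap f\in E$ for all $e,f\in E$; the intersection-closure of $H$ is the minimal intersection-closed hypergraph $H'=(V,E')$ with $E\subseteq E'$. For $e\in E$, an $e$-chain is a sequence $e_0\subsetneq e_1\subsetneq\cdots\subsetneq e_l$ of edges with $e_l=e$, of length $l$; $l_H(e)$ is the maximum length of an $e$-chain in $H$, and $L(H)=\max_{e\in E}l_H(e)$. *)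

(* Defs.v *)
From mathcomp Require Import all_boot.

Set Implicit Arguments.
Unset Strict Implicit.
Unset Printing Implicit Defensive.

(* A hypergraph (V, E) is a finite type V together with its edge set
   E : {set {set V}}; hypergraphs on the same vertex set are compared through
   their edge sets, and the edge V itself is [set: V]. *)

Section Hypergraph.
Variable V : finType.
Implicit Types (E : {set {set V}}) (e : {set V}) (d l : nat).

(* The conditions force i |-> w i and i |-> f i to be injective, so ladders are
   given by their enumerations rather than by the underlying sets W and F. *)
Definition semi_ladder E d (w : 'I_d.+1 -> V) (f : 'I_d.+1 -> {set V}) : Prop :=
  [/\ forall i, f i \in E,
      forall i, w i \notin f i &
      forall i j : 'I_d.+1, i < j -> w i \in f j].

Definition ladder E d (w : 'I_d.+1 -> V) (f : 'I_d.+1 -> {set V}) : Prop :=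
  (forall i, f i \in E) /\ (forall i j : 'I_d.+1, w i \in f j <-> i < j).

Definition semi_ladder_free E d : Prop := ~ exists w f, @semi_ladder E d w f.

Definition ladder_free E d : Prop := ~ exists w f, @ladder E d w f.

Definition inter_closed E : bool :=
  ([set: V] \in E) && [forall e in E, forall f in E, e :&: f \in E].

Definition is_inter_closure E E' : bool :=
  minset (fun D : {set {set V}} => inter_closed D && (E \subset D)) E'.

Lemma semi_ladder_inj E d (w : 'I_d.+1 -> V) (f : 'I_d.+1 -> {set V}) :
  semi_ladder E w f -> injective w /\ injective f.
Proof.
move=> [_ wNf wf]; split=> i j eq_ij;
  case: (ltngtP i j) => [lt|lt|]; try exact: val_inj.
- by have := wf _ _ lt; rewrite eq_ij (negPf (wNf j)).
- by have := wf _ _ lt; rewrite -eq_ij (negPf (wNf i)).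
- by have := wf _ _ lt; rewrite -eq_ij (negPf (wNf i)).
- by have := wf _ _ lt; rewrite eq_ij (negPf (wNf j)).
Qed.

Lemma inter_closureP E E' :
  is_inter_closure E E' <->
  E' = \bigcap_(D : {set {set V}} | inter_closed D && (E \subset D)) D.
Proof.
set C := (X in _ = X).
have minC D : inter_closed D && (E \subset D) -> C \subset D.
  by move=> PD; apply: bigcap_inf.
have PC : inter_closed C && (E \subset C).
  apply/andP; split; last by apply/bigcapsP => D /andP[].
  apply/andP; split; first by apply/bigcapP => D /andP[/andP[]].
  apply/forall_inP => e /bigcapP Ce; apply/forall_inP => f /bigcapP Cf.
  apply/bigcapP => D PD; have /andP[/andP[_ /forall_inP DI] _] := PD.
  by apply: (forall_inP (DI e (Ce D PD))); apply: Cf.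
split=> [/minsetP[PE' minE'] | ->]; first by rewrite (minE' C) ?minC.
by apply/minsetP; split=> // D PD sDC; apply/eqP; rewrite eqEsubset sDC minC.
Qed.

(* The sequence c = (e_0, ..., e_l) has l.+1 entries and length l. *)
Definition is_chain E e l (c : l.+1.-tuple {set V}) : bool :=
  [&& all [in E] c, sorted [rel A B : {set V} | A \proper B] c
    & tnth c ord_max == e].

Lemma is_chain_leq E e l (c : l.+1.-tuple {set V}) :
  is_chain E e c -> l <= #|V|.
Proof.
have bound (q : seq {set V}) A :
    path [rel A B : {set V} | A \proper B] A q -> size q + #|A| <= #|V|.
  elim: q A => [|B q IHq] A /=; first by rewrite max_card.
  by case/andP=> /proper_card ltAB /IHq; apply: leq_trans;
    rewrite addSnnS leq_add2l.
case/and3P=> _ + _; have := size_tuple c; case: (tval c) => //= A q [<-] /bound.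
by apply: leq_trans; apply: leq_addr.
Qed.

(* By is_chain_leq the bound on l excludes no chain, so this is the maximum
   length of an e-chain; for e in E the chain (e) has length 0. *)
Definition chain_length E e : nat :=
  \max_(l < #|V|.+1 | [exists c : l.+1.-tuple {set V}, is_chain E e c]) l.

Definition max_chain_length E : nat := \max_(e in E) chain_length E e.

End Hypergraph.

(* Main.v *)
Require Import Defs.
From mathcomp Require Import all_boot.

(** A chain [e_0 < ... < e_{n+1}] and points [w_i \in e_{i+1} :\: e_i] form an
    [n]-ladder.  When the [e_i] lie in the intersection-closure, each of them is
    the intersection of the original edges above it, so some original edge
    [f_i] contains [e_i] but not [w_i], and this gives an [n]-semi-ladder of the
    original hypergraph.  Conversely, the intersections of the tails
    [f_i, ..., f_n] of a semi-ladder, followed by the whole vertex set, form a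
    chain of length [n+1]. *)

Section Chains.
Set Implicit Arguments.
Unset Strict Implicit.
Variable V : finType.
Implicit Types (E D : {set {set V}}) (e : {set V}) (g : nat -> {set V}).

(** Indexing by [nat] spares casts between ordinals; values of [g] beyond [l] are arbitrary. *)
Definition edge_chain E l g : Prop :=
  (forall i, i <= l -> g i \in E) /\ (forall i, i < l -> g i \proper g i.+1).

Lemma edge_chain_sub E l g i j :
  edge_chain E l g -> i <= j <= l -> g i \subset g j.
Proof.
move=> [_ gP]; elim: j => [|j IHj] /andP[].
  by rewrite leqn0 => /eqP->.
rewrite leq_eqVlt => /predU1P[-> //|le_ij] lt_jl.
by rewrite (subset_trans (IHj _)) ?proper_sub ?gP // -ltnS le_ij ltnW.
Qed.

(** A chain longer than [l.+1] may be cut after its entry of index [l.+1]. This changes its top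
    edge, which is harmless because the maximum runs over all edges. *)
Lemma max_chain_lengthP E l :
  reflect (exists g, edge_chain E l.+1 g) (l < max_chain_length E).
Proof.
apply: (iffP idP) => [|[g [gE gP]]].
  case: (boolP [exists e in E, l < chain_length E e]); last first.
    rewrite negb_exists_in => /forall_inP small.
    rewrite ltnNge => /negP[]; apply/bigmax_leqP => e /small.
    by rewrite -leqNgt.
  case/exists_inP=> e _ lt_l _.
  case: (boolP [exists k : 'I_#|V|.+1, (l < k) &&
           [exists c : k.+1.-tuple {set V}, is_chain E e c]]); last first.
    rewrite negb_exists => /forallP small; move: lt_l; rewrite ltnNge.
    case/negP; apply/bigmax_leqP => k Pk; rewrite leqNgt.
    by apply: contraNN (small k) => ->.
  case/existsP=> k /andP[lt_lk /existsP[c /and3P[/allP cE c_sorted _]]].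
  (* Only indices up to [l.+1 <= k] matter, so the default [set0] is never read. *)
  exists (nth set0 c); split=> i lti.
    by apply: cE; rewrite mem_nth // size_tuple ltnS (leq_trans lti).
  apply: (sortedP set0 c_sorted).
  by rewrite size_tuple ltnS (leq_trans lti).
pose c := [tuple g i | i < l.+2].
have chain_c : is_chain E (g l.+1) c.
  apply/and3P; split; last by rewrite tnth_mktuple.
    by apply/allP => _ /tnthP[i ->]; rewrite tnth_mktuple gE // -ltnS.
  have -> : tval c = mkseq g l.+2.
    by rewrite /mkseq -val_enum_ord -map_comp -[enum _]val_ord_tuple.
  apply/(sortedP set0) => i; rewrite size_mkseq => lti.
  by rewrite !nth_mkseq ?(ltnW lti) //; apply: gP.
(* The maximum in [chain_length] runs over ordinals below [#|V|.+1], so the length must first be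
   shown to be in range. *)
have ltlV : l.+1 < #|V|.+1 by rewrite ltnS (is_chain_leq chain_c).
apply: leq_trans (leq_bigmax_cond _ (gE _ (leqnn _))).
by apply: (bigmax_sup (Ordinal ltlV)) => //; apply/existsP; exists c.
Qed.

Lemma edge_chain_witness E n g :
  edge_chain E n.+1 g ->
  exists w : 'I_n.+1 -> V, forall i, w i \in g i.+1 :\: g i.
Proof.
move=> [_ gP].
have gD (i : 'I_n.+1) : exists x, x \in g i.+1 :\: g i.
  have /properP[_ [x gx gNx]] := gP i (ltn_ord i).
  by exists x; rewrite inE gNx.
by exists (fun i => xchoose (gD i)) => i; apply: xchooseP.
Qed.

(** Monotonicity decides membership: [w i] lies in [g i.+1], hence in [g j] for [i < j], and is
    missed by [g i], hence by [g j] for [j <= i]. The top set [g n.+1] only supplies the last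
    point. *)
Lemma edge_chain_ladder E n g :
  edge_chain E n.+1 g -> exists w f, @ladder V E n w f.
Proof.
move=> gC; have [w wP] := edge_chain_witness gC.
exists w, (fun i => g i); split=> [i|i j].
  by apply: gC.1; rewrite ltnW.
have /setDP[gw gNw] := wP i; split=> [|lt_ij].
  apply: contraTT; rewrite -leqNgt => le_ji; apply: contra gNw.
  by apply/subsetP/(edge_chain_sub gC); rewrite le_ji ltnW.
by apply: subsetP gw; apply: (edge_chain_sub gC); rewrite lt_ij ltnW.
Qed.

Lemma ladder_semi_ladder E n w f : @ladder V E n w f -> semi_ladder E w f.
Proof.
case=> fE wf; split=> // [i|i j /wf //].
by apply/negP => /wf; rewrite ltnn.
Qed.

Lemma semi_ladderS E D n w f :
  E \subset D -> @semi_ladder V E n w f -> semi_ladder D w f.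
Proof. by move=> /subsetP sED [fE wNf wf]; split=> // i; apply: sED. Qed.

Lemma inter_closed_bigcap E (I : finType) (P : pred I) (F : I -> {set V}) :
  inter_closed E -> (forall i, P i -> F i \in E) ->
  \bigcap_(i | P i) F i \in E.
Proof.
case/andP=> ET /forall_inP EI FE; elim/big_ind: _ => // e f eE fE.
exact: (forall_inP (EI e eE)).
Qed.

Lemma semi_ladder_edge_chain E n w f :
  inter_closed E -> @semi_ladder V E n w f -> exists g, edge_chain E n.+1 g.
Proof.
move=> closedE [fE wNf wf].
(* At [i = n.+1] the index range is empty and the intersection is the whole vertex set, which gives
   the extra top edge. *)
exists (fun i => \bigcap_(j : 'I_n.+1 | i <= j) f j); split=> i lti.
  exact: inter_closed_bigcap.
apply/properP; split.
  by apply/bigcapsP => j lt_ij; apply: bigcap_inf; apply: ltnW.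
(* The point [w i] lies in every later [f j] but not in [f i], so the inclusion is strict. *)
exists (w (Ordinal lti)); first by apply/bigcapP => j lt_ij; apply: wf.
by apply/bigcapP => /(_ (Ordinal lti) (leqnn i)); apply/negP.
Qed.

Lemma inter_closure_closed E E' : is_inter_closure E E' -> inter_closed E'.
Proof. by case/minsetP=> /andP[]. Qed.

Lemma inter_closure_sub E E' : is_inter_closure E E' -> E \subset E'.
Proof. by case/minsetP=> /andP[]. Qed.

(** The sets separated from each outside point by an edge of [E] form an intersection-closed family
    [D] containing [E], so [D] contains the closure. *)
Lemma inter_closure_separate E E' e x :
  is_inter_closure E E' -> e \in E' -> x \notin e ->
  exists2 f, f \in E & (e \subset f) && (x \notin f).
Proof.
move=> /inter_closureP -> + xNe.
pose D := [set e : {set V} | [forall (y | y \notin e),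
            exists f in E, (e \subset f) && (y \notin f)]].
have D_closed : inter_closed D && (E \subset D).
  apply/andP; split; last first.
    apply/subsetP => a aE; rewrite inE; apply/forall_inP => y yNa.
    by apply/exists_inP; exists a; rewrite ?subxx.
  apply/andP; split.
    by rewrite inE; apply/forall_inP => y; rewrite inE.
  apply/forall_inP => a; rewrite inE => /forall_inP Da.
  apply/forall_inP => b; rewrite inE => /forall_inP Db.
  rewrite inE; apply/forall_inP => y; rewrite inE negb_and.
  (* A point outside the intersection is outside [a] or [b], and the edge separating it from that
     set still works. *)
  case/orP=> [/Da|/Db] /exists_inP[f fE /andP[sf yNf]];
    apply/exists_inP; exists f; rewrite ?yNf ?andbT //.
    exact: subset_trans (subsetIl _ _) sf.
  exact: subset_trans (subsetIr _ _) sf.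
move/bigcapP/(_ D D_closed); rewrite inE => /forall_inP/(_ x xNe)/exists_inP.
by case=> f fE ?; exists f.
Qed.

(** Replacing [g j] by a larger edge keeps the memberships for [i < j]. Among the non-memberships
    only the diagonal ones are secured, hence a semi-ladder. *)
Lemma edge_chain_semi_ladder E E' n g :
  is_inter_closure E E' -> edge_chain E' n.+1 g ->
  exists w f, @semi_ladder V E n w f.
Proof.
move=> clE gC; have [w wP] := edge_chain_witness gC.
have ex_f (i : 'I_n.+1) :
    exists f, (f \in E) && ((g i \subset f) && (w i \notin f)).
  have /setDP[_ wNg] := wP i.
  have [|f fE ?] := inter_closure_separate clE _ wNg; last by exists f; rewrite fE.
  by apply: gC.1; rewrite ltnW.
exists w, (fun i => xchoose (ex_f i)); split=> [i|i|i j lt_ij].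
- by case/and3P: (xchooseP (ex_f i)).
- by case/and3P: (xchooseP (ex_f i)).
case/and3P: (xchooseP (ex_f j)) => _ /subsetP sgf _; apply: sgf.
have /setDP[gw _] := wP i; apply: subsetP gw.
by apply: (edge_chain_sub gC); rewrite lt_ij ltnW.
Qed.

End Chains.

Theorem theorem1 (V : finType) (E E' : {set {set V}}) (d : nat)
    (hE' : is_inter_closure E E') (hd : 0 < d) :
  (semi_ladder_free E d.+1 <-> ladder_free E' d.+1) /\
  (ladder_free E' d.+1 <-> max_chain_length E' <= d.+1).
Proof.
have closedE' := inter_closure_closed hE'.
(* Both equivalences pass through chains of length [d.+2] in [E'], whose existence means
   [d.+1 < max_chain_length E']. *)
have ladder_chain : (exists w f, @ladder V E' d.+1 w f) ->
    exists g, edge_chain E' d.+2 g.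
  move=> [w [f /ladder_semi_ladder]]; exact: semi_ladder_edge_chain.
split; split.
- move=> freeE /ladder_chain[g gC]; apply: freeE.
  exact: edge_chain_semi_ladder hE' gC.
- move=> freeE' [w [f /(semi_ladderS (inter_closure_sub hE'))]].
  by case/(semi_ladder_edge_chain closedE')=> g /edge_chain_ladder.
- move=> freeE'; rewrite leqNgt; apply/negP => /max_chain_lengthP[g].
  by move/edge_chain_ladder.
- rewrite leqNgt => /negP short /ladder_chain exg; apply: short.
  exact/max_chain_lengthP.
Qed.
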